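(* Let $[a,b]\subset\mathbb{R}$ be a closed bounded interval and let $f_n:[a,b]\rightarrow\mathbb{R}$ ($n\in\mathbb{N}$) be a sequence of Riemann integrable functions converging pointwise on $[a,b]$ to a function $f:[a,b]\rightarrow\mathbb{R}$ which is also Riemann integrable. Suppose further that there is a constant $C$ such that $|f_n(x)| < C$ for every $x\in[a,b]$ and every $n\in\mathbb{N}$. Then $\int_a^b f = \lim_{n\to\infty}\int_a^b f_n$ (in particular, the limit exists).
   Context: All integrals are Riemann integrals of real-valued functions on a closed bounded interval. *)

(* Defs.v *)
From Stdlib Require Import Reals.
From Coquelicot Require Import Coquelicot.

(* Main.v *)
(** With [g_n = |f_n - f|] and [p_n = sup_{k >= n} g_k], the functions [p_n]
    decrease to 0 and [int g_n] is at most the lower integral [L_n] of [p_n], so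
    it suffices that the limit [l] of the [L_n], an additive function of
    intervals, vanishes. If [l(I) > eps |I|], then for each [n] some closed
    subinterval [J] satisfies both [l(J) > eps |J|] and [p_n >= eps] on [J];
    nesting such intervals yields a point where no [p_n] falls below [eps]. *)

Require Import Defs.
From Stdlib Require Import Reals Lra Lia Classical ClassicalEpsilon.
From Coquelicot Require Import Coquelicot.
Open Scope R_scope.

(** * Step functions and their integrals *)

(** Induction along the subdivision, gluing one piece at a time on the right. Constancy is only
    available on open pieces, as a step function is unconstrained at the subdivision points. *)
Lemma IsStepFun_interval_ind (phi : R -> R) (a b : R) (P : R -> R -> Prop) :
  a <= b -> IsStepFun phi a b ->
  (forall u v, a <= u <= v -> v <= b ->
     (exists c, forall x, u < x < v -> phi x = c) -> P u v) ->
  (forall u v w, a <= u <= v -> v <= w <= b -> P u v -> P v w -> P u w) ->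
  P a b.
Proof.
intros Hab [l [lf [Hl [H0 [H1 [_ Hc]]]]]] Hpiece Hglue.
rewrite (Rmin_left _ _ Hab) in H0; rewrite (Rmax_right _ _ Hab) in H1.
assert (Hmono : forall i j, (i <= j)%nat -> (j <= pred (length l))%nat ->
  RList.pos_Rl l i <= RList.pos_Rl l j).
{ intros i j Hij; induction Hij as [|j Hij IH]; intros Hj; [lra|].
  apply Rle_trans with (RList.pos_Rl l j); [apply IH; lia | apply Hl; lia]. }
assert (Hind : forall i, (i <= pred (length l))%nat -> P a (RList.pos_Rl l i)).
{ induction i as [|i IH]; intros Hi.
  - rewrite H0; apply Hpiece; try lra; exists 0; intros; lra.
  - assert (Ha := Hmono 0%nat i ltac:(lia) ltac:(lia)).
    assert (Hs := Hmono i (S i) ltac:(lia) ltac:(lia)).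
    assert (Hb := Hmono (S i) _ Hi (le_n _)).
    apply Hglue with (RList.pos_Rl l i); try lra.
    + apply IH; lia.
    + apply Hpiece; try lra.
      exists (RList.pos_Rl lf i); apply (Hc i); lia. }
rewrite <- H1; apply Hind; lia.
Qed.

(** A step function approximates itself with error function 0, so the constant sequence [phi] may
    replace the approximating sequence that defines [RiemannInt]. *)
Lemma RInt_StepFun (a b : R) (phi : StepFun a b) :
  ex_RInt phi a b /\ RInt phi a b = RiemannInt_SF phi.
Proof.
assert (Hz : forall (eps : posreal),
  (forall t, Rmin a b <= t <= Rmax a b ->
     Rabs (phi t - phi t) <= mkStepFun (StepFun_P4 a b 0) t) /\
  Rabs (RiemannInt_SF (mkStepFun (StepFun_P4 a b 0))) < eps).
{ intros eps; split.
  - intros t _; simpl; unfold fct_cte; rewrite Rminus_diag, Rabs_R0; lra.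
  - rewrite StepFun_P18, Rmult_0_l, Rabs_R0; apply cond_pos. }
assert (pr : Riemann_integrable phi a b).
{ intros eps; exists phi; exists (mkStepFun (StepFun_P4 a b 0)); apply Hz. }
split; [now apply ex_RInt_Reals_1|].
rewrite (RInt_Reals _ _ _ pr); unfold RiemannInt.
destruct (RiemannInt_exists pr RinvN RinvN_cv) as [l Hl].
pose (psi1 := fun n => proj1_sig (phi_sequence_prop RinvN pr n)).
assert (Hcv : Un_cv (fun _ : nat => RiemannInt_SF phi) l).
{ apply (RiemannInt_P11 phi RinvN (phi_sequence RinvN pr) (fun _ => phi) psi1
    (fun _ => mkStepFun (StepFun_P4 a b 0))).
  - exact RinvN_cv.
  - intros n; unfold psi1; destruct (phi_sequence_prop RinvN pr n) as [x Hx];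
    exact Hx.
  - intros n; apply Hz.
  - exact Hl. }
apply (UL_sequence _ _ _ Hcv).
intros e He; exists 0%nat; intros n _; unfold Rdist.
now rewrite Rminus_diag, Rabs_R0.
Qed.

(** If [phi] approximates [h] within [psi], then [phi - psi <= h <= phi + psi]. The minorant
    [phi - psi] loses at most twice the integral of [psi], hence the tolerance [eta / 2]. *)
Lemma ex_RInt_StepFun_below (h : R -> R) (a b eta : R) :
  a <= b -> 0 < eta -> ex_RInt h a b ->
  exists phi : StepFun a b, ex_RInt phi a b /\
    (forall x, a <= x <= b -> phi x <= h x) /\
    RInt h a b - eta < RInt phi a b.
Proof.
intros Hab Heta Hh.
assert (He2 : 0 < eta / 2) by lra.
destruct (ex_RInt_Reals_0 _ _ _ Hh (mkposreal _ He2)) as [phi [psi [Hpsi Hint]]].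
rewrite (Rmin_left _ _ Hab), (Rmax_right _ _ Hab) in Hpsi; simpl in Hint.
apply Rabs_def2 in Hint.
destruct (RInt_StepFun a b phi) as [Ephi _].
destruct (RInt_StepFun a b psi) as [Epsi Ipsi].
destruct (RInt_StepFun a b (mkStepFun (StepFun_P28 (-1) phi psi))) as [Em Im].
destruct (RInt_StepFun a b (mkStepFun (StepFun_P28 1 phi psi))) as [Ep Ip].
destruct (RInt_StepFun a b phi) as [_ Iphi].
rewrite StepFun_P30, <- Iphi, <- Ipsi in Im, Ip; rewrite <- Ipsi in Hint.
simpl in Em, Im, Ep, Ip.
exists (mkStepFun (StepFun_P28 (-1) phi psi)); simpl.
split; [exact Em|]; split.
- intros x Hx; specialize (Hpsi x Hx); apply Rabs_le_between in Hpsi; lra.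
- assert (RInt h a b <= RInt (fun x => phi x + 1 * psi x) a b).
  { apply RInt_le; auto; intros x Hx.
    assert (Hp := Hpsi x ltac:(lra)); apply Rabs_le_between in Hp; lra. }
  rewrite Im; lra.
Qed.

(** * Suprema and lower integrals of bounded functions *)

Lemma is_lub_real_Lub_Rbar (E : R -> Prop) (y0 M : R) :
  E y0 -> (forall y, E y -> y <= M) -> is_lub E (real (Lub_Rbar E)).
Proof.
intros Hy HM; destruct (Lub_Rbar_correct E) as [Hub Hleast].
assert (H0 := Hub _ Hy).
assert (H1 : Rbar_le (Lub_Rbar E) M) by (apply Hleast; intros y; apply HM).
destruct (Lub_Rbar E) as [l| |]; try contradiction; split.
- intros y; apply Hub.
- intros m Hm; apply (Hleast (Finite m)); exact Hm.
Qed.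

Lemma is_lub_approx (E : R -> Prop) (m eta : R) :
  is_lub E m -> 0 < eta -> exists y, E y /\ m - eta < y.
Proof.
intros [_ Hm] Heta; apply NNPP; intros Hn.
assert (m <= m - eta); [|lra].
apply Hm; intros y Hy; apply Rnot_lt_le; intros Hlt; apply Hn; now exists y.
Qed.

Definition lower_sums (p : R -> R) (u v y : R) : Prop :=
  exists h, ex_RInt h u v /\ (forall x, u <= x <= v -> h x <= p x) /\
    y = RInt h u v.

Definition lower_int (p : R -> R) (u v : R) : R :=
  real (Lub_Rbar (lower_sums p u v)).

Lemma lower_sums_le (p : R -> R) (M u v y : R) :
  u <= v -> (forall x, p x <= M) -> lower_sums p u v y -> y <= M * (v - u).
Proof.
intros Huv Hp [h [Eh [Hh ->]]].
replace (M * (v - u)) with (RInt (fun _ => M) u v).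
- apply RInt_le; auto; [apply ex_RInt_const|].
  intros x Hx; apply Rle_trans with (p x); [apply Hh; lra | apply Hp].
- rewrite RInt_const; unfold scal; simpl; unfold mult; simpl; ring.
Qed.

Lemma lower_sums_0 (p : R -> R) (u v : R) :
  (forall x, 0 <= p x) -> lower_sums p u v 0.
Proof.
intros Hp; exists (fun _ => 0); split; [apply ex_RInt_const|]; split.
- intros x _; apply Hp.
- rewrite RInt_const; unfold scal; simpl; unfold mult; simpl; ring.
Qed.

Lemma lower_int_lub (p : R -> R) (M u v : R) :
  u <= v -> (forall x, 0 <= p x <= M) ->
  is_lub (lower_sums p u v) (lower_int p u v).
Proof.
intros Huv Hp; apply is_lub_real_Lub_Rbar with 0 (M * (v - u)).
- apply lower_sums_0; intros x; apply Hp.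
- intros y; apply lower_sums_le; auto; intros x; apply Hp.
Qed.

Lemma lower_int_bounds (p : R -> R) (M u v : R) :
  u <= v -> (forall x, 0 <= p x <= M) -> 0 <= lower_int p u v <= M * (v - u).
Proof.
intros Huv Hp; destruct (lower_int_lub p M u v Huv Hp) as [Hub Hl]; split.
- apply Hub, lower_sums_0; intros x; apply Hp.
- apply Hl; intros y; apply lower_sums_le; auto; intros x; apply Hp.
Qed.

Lemma RInt_le_lower_int (p h : R -> R) (M u v : R) :
  u <= v -> (forall x, 0 <= p x <= M) -> ex_RInt h u v ->
  (forall x, u <= x <= v -> h x <= p x) -> RInt h u v <= lower_int p u v.
Proof.
intros Huv Hp Eh Hh; apply (lower_int_lub p M u v Huv Hp); now exists h.
Qed.

Lemma lower_int_le (p q : R -> R) (M u v : R) :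
  u <= v -> (forall x, 0 <= p x <= M) -> (forall x, 0 <= q x <= M) ->
  (forall x, p x <= q x) -> lower_int p u v <= lower_int q u v.
Proof.
intros Huv Hp Hq Hpq; apply (lower_int_lub p M u v Huv Hp).
intros y [h [Eh [Hh ->]]]; apply RInt_le_lower_int with M; auto.
intros x Hx; apply Rle_trans with (p x); auto.
Qed.

(** A minorant on the whole interval restricts to both halves; conversely, nearly optimal minorants
    on the halves glue to one on the whole. *)
Lemma lower_int_Chasles (p : R -> R) (M u v w : R) :
  u <= v <= w -> (forall x, 0 <= p x <= M) ->
  lower_int p u w = lower_int p u v + lower_int p v w.
Proof.
intros Huvw Hp.
assert (Huv : u <= v) by lra; assert (Hvw : v <= w) by lra.
assert (Huw : u <= w) by lra.
apply Rle_antisym.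
- apply (lower_int_lub p M u w Huw Hp); intros y [h [Eh [Hh ->]]].
  assert (E1 : ex_RInt h u v) by now apply (@ex_RInt_Chasles_1 R_CompleteNormedModule) with w.
  assert (E2 : ex_RInt h v w) by now apply (@ex_RInt_Chasles_2 R_CompleteNormedModule) with u.
  rewrite <- (RInt_Chasles h u v w E1 E2); unfold plus; simpl.
  apply Rplus_le_compat; apply RInt_le_lower_int with M; auto;
    intros x Hx; apply Hh; lra.
- apply Rnot_lt_le; intros Hlt.
  (* Half of the supposed gap, since each of the two minorants loses less than [eta]. *)
  set (eta := (lower_int p u v + lower_int p v w - lower_int p u w) / 2).
  assert (Heta : 0 < eta) by (unfold eta; lra).
  destruct (is_lub_approx _ _ _ (lower_int_lub p M u v Huv Hp) Heta)
    as [y1 [[h1 [E1 [H1 ->]]] L1]].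
  destruct (is_lub_approx _ _ _ (lower_int_lub p M v w Hvw Hp) Heta)
    as [y2 [[h2 [E2 [H2 ->]]] L2]].
  pose (h := fun x => if Rle_dec x v then h1 x else h2 x).
  assert (X1 : forall x, Rmin u v < x < Rmax u v -> h1 x = h x).
  { rewrite (Rmin_left _ _ Huv), (Rmax_right _ _ Huv); intros x Hx; unfold h.
    destruct (Rle_dec x v); [auto | lra]. }
  assert (X2 : forall x, Rmin v w < x < Rmax v w -> h2 x = h x).
  { rewrite (Rmin_left _ _ Hvw), (Rmax_right _ _ Hvw); intros x Hx; unfold h.
    destruct (Rle_dec x v); [lra | auto]. }
  assert (F1 := ex_RInt_ext _ _ _ _ X1 E1); assert (F2 := ex_RInt_ext _ _ _ _ X2 E2).
  rewrite (RInt_ext _ _ _ _ X1) in L1; rewrite (RInt_ext _ _ _ _ X2) in L2.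
  assert (RInt h u w <= lower_int p u w).
  { apply RInt_le_lower_int with M; auto; [now apply ex_RInt_Chasles with v|].
    intros x Hx; unfold h; destruct (Rle_dec x v); [apply H1 | apply H2]; lra. }
  rewrite <- (RInt_Chasles h u v w F1 F2) in H; unfold plus in H; simpl in H.
  unfold eta in *; lra.
Qed.

(** * Limit of the lower integrals of a decreasing sequence *)

Section DecreasingToZero.

Variables (p : nat -> R -> R) (M : R).
Hypothesis p_bounds : forall n x, 0 <= p n x <= M.
Hypothesis p_decr : forall n x, p (S n) x <= p n x.
Hypothesis p_lim : forall x, is_lim_seq (fun n => p n x) 0.

Definition lower_int_lim (u v : R) : R := real (Lim_seq (fun n => lower_int (p n) u v)).

Lemma is_lim_lower_int_lim (u v : R) :
  u <= v -> is_lim_seq (fun n => lower_int (p n) u v) (lower_int_lim u v).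
Proof.
intros Huv; apply Lim_seq_correct', ex_finite_lim_seq_decr with 0; intros n.
- now apply lower_int_le with M.
- now apply (lower_int_bounds (p n) M).
Qed.

Lemma lower_int_lim_le (n : nat) (u v : R) :
  u <= v -> lower_int_lim u v <= lower_int (p n) u v.
Proof.
intros Huv; apply is_lim_seq_decr_compare with (1 := is_lim_lower_int_lim u v Huv).
intros k; now apply lower_int_le with M.
Qed.

Lemma lower_int_lim_Chasles (u v w : R) :
  u <= v <= w -> lower_int_lim u w = lower_int_lim u v + lower_int_lim v w.
Proof.
intros H.
assert (L := is_lim_seq_plus' _ _ _ _
  (is_lim_lower_int_lim u v ltac:(lra)) (is_lim_lower_int_lim v w ltac:(lra))).
assert (Hf : Finite (lower_int_lim u w) =
  Finite (lower_int_lim u v + lower_int_lim v w)); [|congruence].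
apply is_lim_seq_unique in L; rewrite <- L.
symmetry; apply is_lim_seq_unique.
apply is_lim_seq_ext with (2 := is_lim_lower_int_lim u w ltac:(lra)).
intros n; now apply lower_int_Chasles with M.
Qed.

(** Makes the limit negligible on short intervals, so that the ends of a piece can be cut off. *)
Lemma lower_int_lim_le_M (u v : R) : u <= v -> lower_int_lim u v <= M * (v - u).
Proof.
intros Huv; apply Rle_trans with (lower_int (p 0%nat) u v); [now apply lower_int_lim_le|].
now apply (lower_int_bounds (p 0%nat) M).
Qed.

(** Otherwise the limit is at most [eps] times the length wherever [p n >= eps]. Splitting along a
    step minorant [phi] of [p n] bounds it on the whole interval by [eps * (v - u)] plus the defect
    of [phi], which can be made too small for this. *)
Lemma lower_int_lim_subinterval (n : nat) (eps u v : R) :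
  u <= v -> eps * (v - u) < lower_int_lim u v ->
  exists u' v', u <= u' /\ u' <= v' /\ v' <= v /\ eps * (v' - u') < lower_int_lim u' v' /\
    forall x, u' <= x <= v' -> eps <= p n x.
Proof.
intros Huv Hell; apply NNPP; intros Hno.
assert (Hsub : forall u' v', u <= u' <= v' -> v' <= v ->
  (forall x, u' <= x <= v' -> eps <= p n x) -> lower_int_lim u' v' <= eps * (v' - u')).
{ intros u' v' H1 H2 H3; apply Rnot_lt_le; intros H4; apply Hno.
  exists u', v'; repeat split; auto; lra. }
assert (HM : 0 <= M) by (destruct (p_bounds 0%nat 0); lra).
(* Half of the excess: passing from the lower integral to [h], then from [h] to [phi], costs less
   than [eta] each time. *)
set (eta := (lower_int_lim u v - eps * (v - u)) / 2).
assert (Heta : 0 < eta) by (unfold eta; lra).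
destruct (is_lub_approx _ _ _ (lower_int_lub (p n) M u v Huv (p_bounds n)) Heta)
  as [y [[h [Eh [Hh ->]]] Lh]].
destruct (ex_RInt_StepFun_below h u v eta Huv Heta Eh)
  as [phi [Ephi [Hphi Lphi]]].
assert (Hex : forall s t, u <= s <= t -> t <= v -> ex_RInt phi s t).
{ intros s t H1 H2; apply (@ex_RInt_Chasles_2 R_CompleteNormedModule) with u; [lra|].
  apply (@ex_RInt_Chasles_1 R_CompleteNormedModule) with v; [lra | exact Ephi]. }
assert (Hle : forall x, u <= x <= v -> phi x <= p n x).
{ intros x Hx; apply Rle_trans with (h x); auto. }
(* Both sides are additive over intervals, and on a piece where [phi = c]
   either [c >= eps] and [Hsub] applies up to shrinking the piece, or
   [c < eps] bounds the integral of [phi]. *)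
assert (Key : lower_int_lim u v <=
  eps * (v - u) + (lower_int (p n) u v - RInt phi u v)).
{ apply (IsStepFun_interval_ind phi u v
    (fun s t => lower_int_lim s t <=
      eps * (t - s) + (lower_int (p n) s t - RInt phi s t)));
    [exact Huv | apply pre | |].
  - intros s t Hs Ht [c Hc].
    assert (Hlow : RInt phi s t <= lower_int (p n) s t).
    { apply RInt_le_lower_int with M; auto; [lra|].
      intros x Hx; apply Hle; lra. }
    destruct (Rle_lt_dec eps c) as [Hec|Hec].
    + cut (lower_int_lim s t <= eps * (t - s)); [lra|].
      (* A degenerate piece leaves no room for shrinking, but there the limit is at most [M * 0]. *)
      destruct (Req_dec s t) as [<-|Hst].
      { assert (H := lower_int_lim_le_M s s (Rle_refl s)); lra. }
      apply Rle_plus_epsilon; intros d Hd.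
      (* [phi = c] is known only inside the piece, while [Hsub] needs a closed interval, so a strip
         of width [r] is removed at each end. The strips cost at most [2 * r * (M + Rabs eps)],
         hence at most [d]; the added 1 keeps [K] positive. *)
      set (K := Rabs eps + M + 1).
      assert (HK : 0 < K) by (unfold K; generalize (Rabs_pos eps); lra).
      set (r := Rmin ((t - s) / 2) (d / (2 * K))).
      assert (Hr0 : 0 < r).
      { apply Rmin_pos; [lra | apply Rdiv_lt_0_compat; lra]. }
      assert (Hr1 : r <= (t - s) / 2) by apply Rmin_l.
      assert (Hr2 : 2 * K * r <= d).
      { apply Rle_trans with (2 * K * (d / (2 * K))).
        - apply Rmult_le_compat_l; [lra | apply Rmin_r].
        - right; field; lra. }
      rewrite (lower_int_lim_Chasles s (s + r) t) by lra.
      rewrite (lower_int_lim_Chasles (s + r) (t - r) t) by lra.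
      assert (H1 := lower_int_lim_le_M s (s + r) ltac:(lra)).
      assert (H2 := lower_int_lim_le_M (t - r) t ltac:(lra)).
      assert (H3 : lower_int_lim (s + r) (t - r) <= eps * (t - r - (s + r))).
      { apply Hsub; try lra; intros x Hx.
        apply Rle_trans with (phi x); [rewrite Hc; lra | apply Hle; lra]. }
      assert (- Rabs eps <= eps) by (generalize (Rabs_maj2 eps); lra).
      unfold K in Hr2; nra.
    + assert (RInt phi s t <= eps * (t - s)).
      { apply (lower_sums_le (fun _ => eps)); [lra | intros; lra |].
        exists (fun _ => c); split; [apply ex_RInt_const|]; split; [intros; lra|].
        apply RInt_ext; rewrite Rmin_left, Rmax_right by lra; exact Hc. }
      assert (H1 := lower_int_lim_le n s t ltac:(lra)); lra.
  - intros s t w H1 H2 P1 P2.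
    rewrite (lower_int_lim_Chasles s t w), (lower_int_Chasles (p n) M s t w) by (auto; lra).
    rewrite <- (RInt_Chasles phi s t w) by (apply Hex; lra).
    unfold plus; simpl; lra. }
unfold eta in *; lra.
Qed.

Lemma lower_int_lim_eq_0 (a b : R) : a <= b -> lower_int_lim a b = 0.
Proof.
intros Hab; apply Rle_antisym.
2:{ apply (is_lim_seq_le (fun _ => 0) (fun n => lower_int (p n) a b) 0 (lower_int_lim a b)).
    - intros n; now apply (lower_int_bounds (p n) M).
    - apply is_lim_seq_const.
    - now apply is_lim_lower_int_lim. }
apply Rnot_lt_le; intros Hpos.
assert (Hlen : 0 < b - a + 1) by lra.
(* The added 1 makes [eps * (b - a)] strictly less than the limit and also covers [a = b]. *)
set (eps := lower_int_lim a b / (b - a + 1)).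
assert (Heps : 0 < eps) by now apply Rdiv_lt_0_compat.
pose (good := fun I : R * R =>
  fst I <= snd I /\ eps * (snd I - fst I) < lower_int_lim (fst I) (snd I)).
assert (H0 : good (a, b)).
{ split; simpl; [exact Hab|].
  assert (eps * (b - a + 1) = lower_int_lim a b) by (unfold eps; field; lra); lra. }
assert (Hstep : forall (n : nat) (I : {I | good I}), exists J : {J | good J},
  fst (proj1_sig I) <= fst (proj1_sig J) /\ snd (proj1_sig J) <= snd (proj1_sig I) /\
  forall x, fst (proj1_sig J) <= x <= snd (proj1_sig J) -> eps <= p n x).
{ intros n [[u v] [Huv Hl]]; simpl in *.
  destruct (lower_int_lim_subinterval n eps u v Huv Hl) as [u' [v' [H1 [H2 [H3 [H4 H5]]]]]].
  exists (exist good (u', v') (conj H2 H4)); simpl; auto. }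
(* Intervals are carried together with their proof of [good], so that the choice of a subinterval
   can be iterated. *)
pose (next := fun n I =>
  proj1_sig (constructive_indefinite_description _ (Hstep n I))).
pose (I := fix I n := match n with
  | O => exist good (a, b) H0
  | S n => next n (I n)
  end).
pose (l := fun n => fst (proj1_sig (I n))); pose (r := fun n => snd (proj1_sig (I n))).
assert (HI : forall n, l n <= l (S n) /\ r (S n) <= r n /\
  forall x, l (S n) <= x <= r (S n) -> eps <= p n x).
{ intros n; unfold l, r; simpl; unfold next.
  exact (proj2_sig (constructive_indefinite_description _ (Hstep n (I n)))). }
assert (Hlr : forall n, l n <= r n) by (intros n; apply (proj2_sig (I n))).
assert (Hl : forall n k, l n <= l (n + k)%nat).
{ intros n k; induction k as [|k IH]; [rewrite Nat.add_0_r; lra|].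
  rewrite Nat.add_succ_r; destruct (HI (n + k)%nat); lra. }
assert (Hr : forall n k, r (n + k)%nat <= r n).
{ intros n k; induction k as [|k IH]; [rewrite Nat.add_0_r; lra|].
  rewrite Nat.add_succ_r; destruct (HI (n + k)%nat) as [_ [? _]]; lra. }
assert (Hcross : forall n m, l n <= r m).
{ intros n m; apply Rle_trans with (l (n + m)%nat); [apply Hl|].
  apply Rle_trans with (r (n + m)%nat); [apply Hlr|].
  rewrite Nat.add_comm; apply Hr. }
(* The supremum of the left endpoints lies in all the nested intervals. *)
destruct (completeness (fun y => exists n, y = l n)) as [x [Hub Hleast]].
{ exists (r 0%nat); intros y [n ->]; apply Hcross. }
{ now exists (l 0%nat), 0%nat. }
assert (eps <= 0); [|lra].
apply (is_lim_seq_le (fun _ => eps) (fun n => p n x) eps 0).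
(* The bound on [p n] holds on interval [S n], the one chosen at step [n]. *)
- intros n; apply HI; split.
  + apply Hub; now exists (S n).
  + apply Hleast; intros y [k ->]; apply Hcross.
- apply is_lim_seq_const.
- apply p_lim.
Qed.

End DecreasingToZero.

(** * Tail suprema and the bounded convergence theorem *)

Definition tail_sup (g : nat -> R -> R) (n : nat) (x : R) : R :=
  real (Lub_Rbar (fun y => exists k, (n <= k)%nat /\ y = g k x)).

Lemma tail_sup_lub (g : nat -> R -> R) (M : R) (n : nat) (x : R) :
  (forall k, g k x <= M) ->
  is_lub (fun y => exists k, (n <= k)%nat /\ y = g k x) (tail_sup g n x).
Proof.
intros Hg; apply is_lub_real_Lub_Rbar with (g n x) M.
- now exists n.
- intros y [k [_ ->]]; apply Hg.
Qed.

(** Tail suprema give monotonicity but may fail to be Riemann integrable; their lower integrals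
    still dominate the integrals of [g n], and a squeeze concludes. *)
Lemma is_lim_seq_RInt_bounded_0 (g : nat -> R -> R) (a b M : R) :
  a <= b -> (forall n, ex_RInt (g n) a b) ->
  (forall n x, 0 <= g n x <= M) ->
  (forall x, is_lim_seq (fun n => g n x) 0) ->
  is_lim_seq (fun n => RInt (g n) a b) 0.
Proof.
intros Hab Eg Hg Hlim.
set (p := tail_sup g).
assert (Hp : forall n x,
  is_lub (fun y => exists k, (n <= k)%nat /\ y = g k x) (p n x)).
{ intros n x; apply (tail_sup_lub g M); intros k; apply Hg. }
assert (Hgp : forall n x, g n x <= p n x).
{ intros n x; apply (Hp n x); now exists n. }
assert (Hpb : forall n x, 0 <= p n x <= M).
{ intros n x; split.
  - apply Rle_trans with (g n x); [apply Hg | apply Hgp].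
  - apply (Hp n x); intros y [k [_ ->]]; apply Hg. }
assert (Hpd : forall n x, p (S n) x <= p n x).
{ intros n x; apply (Hp (S n) x); intros y [k [Hk ->]].
  apply (Hp n x); exists k; split; [lia | auto]. }
assert (Hpl : forall x, is_lim_seq (fun n => p n x) 0).
{ intros x; apply is_lim_seq_spec; intros eps.
  (* Passing to the supremum keeps only a weak inequality; halving [eps] restores strictness. *)
  assert (He : 0 < eps / 2) by (destruct eps as [e he]; simpl; lra).
  assert (Hx := Hlim x); apply is_lim_seq_spec in Hx.
  destruct (Hx (mkposreal _ He)) as [N HN]; simpl in HN.
  exists N; intros n Hn; rewrite Rminus_0_r, Rabs_pos_eq by apply Hpb.
  apply Rle_lt_trans with (eps / 2); [|lra].
  apply (Hp n x); intros y [k [Hk ->]].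
  specialize (HN k ltac:(lia)); apply Rabs_def2 in HN; lra. }
apply is_lim_seq_le_le with (fun _ => 0) (fun n => lower_int (p n) a b).
- intros n; split.
  + apply RInt_ge_0; auto; intros x _; apply Hg.
  + apply RInt_le_lower_int with M; auto.
- apply is_lim_seq_const.
- rewrite <- (lower_int_lim_eq_0 p M Hpb Hpd Hpl a b Hab).
  now apply is_lim_lower_int_lim with M.
Qed.

Theorem theorem1
  (a b : R) (Hab : a <= b)
  (fn : nat -> R -> R) (f : R -> R)
  (Hfn_int : forall n : nat, ex_RInt (fn n) a b)
  (Hf_int : ex_RInt f a b)
  (Hlim : forall x : R, a <= x <= b ->
     is_lim_seq (fun n : nat => fn n x) (Finite (f x)))
  (C : R)
  (Hbound : forall (n : nat) (x : R), a <= x <= b -> Rabs (fn n x) < C) :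
  is_lim_seq (fun n : nat => RInt (fn n) a b) (Finite (RInt f a b)).
Proof.
assert (Hd : forall n, ex_RInt (fun x => fn n x - f x) a b).
{ intros n; now apply @ex_RInt_minus. }
(* The function is set to 0 off the interval because the convergence lemma asks for bounds and
   limits on the whole line; the integrals do not change. *)
pose (g := fun n x =>
  if excluded_middle_informative (a <= x <= b) then Rabs (fn n x - f x) else 0).
assert (Hg : forall n x, Rmin a b < x < Rmax a b -> Rabs (fn n x - f x) = g n x).
{ intros n x; rewrite (Rmin_left _ _ Hab), (Rmax_right _ _ Hab); intros Hx.
  unfold g; destruct (excluded_middle_informative (a <= x <= b)); [auto | lra]. }
(* Off the interval, the bound [0 <= 2 * C] rests on this. *)
assert (HC : 0 < C).
{ generalize (Hbound 0%nat a ltac:(lra)), (Rabs_pos (fn 0%nat a)); lra. }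
assert (Hf : forall x, a <= x <= b -> Rabs (f x) <= C).
{ intros x Hx.
  apply (is_lim_seq_le (fun n => Rabs (fn n x)) (fun _ => C) (Rabs (f x)) C).
  - intros n; left; auto.
  - exact (is_lim_seq_abs _ _ (Hlim x Hx)).
  - apply is_lim_seq_const. }
assert (Hg0 : is_lim_seq (fun n => RInt (g n) a b) 0).
{ apply is_lim_seq_RInt_bounded_0 with (2 * C); auto.
  - intros n; apply (ex_RInt_ext _ _ _ _ (Hg n)).
    now apply (ex_RInt_norm (fun x => fn n x - f x)).
  - intros n x; unfold g; destruct (excluded_middle_informative (a <= x <= b)).
    + split; [apply Rabs_pos|].
      generalize (Rabs_triang (fn n x) (- f x)) (Hbound n x a0) (Hf x a0).
      rewrite Rabs_Ropp; unfold Rminus; lra.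
    + lra.
  - intros x; unfold g; destruct (excluded_middle_informative (a <= x <= b)).
    + rewrite <- Rabs_R0 at 1; apply (is_lim_seq_abs _ (Finite 0)).
      replace 0 with (f x - f x) by ring.
      apply is_lim_seq_minus'; [now apply Hlim | apply is_lim_seq_const].
    + apply is_lim_seq_const. }
apply is_lim_seq_spec; intros eps; apply is_lim_seq_spec in Hg0.
destruct (Hg0 eps) as [N HN]; exists N; intros n Hn; specialize (HN n Hn).
apply Rle_lt_trans with (RInt (g n) a b).
(* Written with [minus], the two integrals merge by [RInt_minus], and the absolute value moves
   inside. *)
- change (Rabs (minus (RInt (fn n) a b) (RInt f a b)) <= RInt (g n) a b).
  rewrite <- RInt_minus by auto.
  rewrite <- (RInt_ext _ _ _ _ (Hg n)).
  now apply (abs_RInt_le (fun x => fn n x - f x)).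
- apply Rabs_def2 in HN; lra.
Qed.
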